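(* Let $L$ be a universal language. There exist two concepts $a,b\in C_L$ and a complexity function $\mathsf f$ such that $$K(a|b)<K(b|a)\quad\text{and}\quad TS_\ell^{\mathsf f}(a|b)>TS_\ell^{\mathsf f}(b|a).$$
   Context: Languages and programs. $L$ is a universal (Turing-complete) language whose programs are finite sequences of instructions from a finite alphabet $\Upsilon$, each instruction coded with the same number $\log_2|\Upsilon|$ of bits. Let $\Sigma=\{0,1\}^*$. For a program $p$, $\dot\ell(p)$ is its length in number of instructions and $\ell(p)$ its length in bits. $\prec$ is the total order on programs given first by length and then, for equal length, by lexicographic order over $\Upsilon$. A program $p$ computes a map $\Sigma\to\Sigma\cup\{\perp\}$, where $p(\mathtt i)=\perp$ means that $p$ does not halt on $\mathtt i$. An $L$-concept is a function $c:\Sigma\to\Sigma\cup\{\perp\}$ computed by at least one program of $L$; $C_L$ is the set of $L$-concepts and $[c]_L$ the set of programs of $L$ computing $c$. Libraries. A library is a finite set $B=\{p_1,\dots,p_k\}$ of programs (primitives). $\Upsilon$ always includes an instruction $@$ for static library calls, and $@$ is the last instruction in the lexicographic order. $@\mathsf i$ denotes the instruction calling the primitive of index $\mathsf i$ (no index is needed if $|B|=1$). A call has length $\ell(@\mathsf i)=\log_2|\Upsilon|+\log_2|B|$ bits. $L_B$ is the language $L$ with static calls to $B$; $[c]_{L_B}$ is the set of programs of $L_B$ computing $c$. Examples. $X=\Sigma\times(\Sigma\cup\{\perp\})$. An example set is a finite subset $S$ of $X$ without different outputs for equal inputs. $\delta(S)$ is the number of bits of the encoding of $S$ by a fixed prefix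 (self-delimiting) code. $\lessdot$ is a fixed total order on example sets such that $S\lessdot S'$ implies $\delta(S)\le\delta(S')$. Time-bounded compatibility. $\lambda_L(\mathtt i,S)$ is a time bound (in steps, for input $\mathtt i$), of the form $\rho\cdot\min\{\ell(\mathtt i),\ell(\mathtt i_{max})\}+\ell(\mathtt o_{max})$ with $\rho$ a constant and $\mathtt i_{max},\mathtt o_{max}$ the longest input and output in $S$, that suffices for a program hard-coding $S$ as a trie (lookup table). A complexity function is a function $\mathsf f:\mathbb N\to\mathbb N$ acting as a time bound. $p\vDash_{\mathsf f}S$ means that for each $\langle \mathtt i,\mathtt o\rangle\in S$, within $\max\{\mathsf f(\ell(\mathtt i)),\lambda_L(\mathtt i,S)\}$ time steps, $p$ on input $\mathtt i$ outputs $\mathtt o$ if $\mathtt o\ne\perp$, and does not halt if $\mathtt o=\perp$. Learner, teacher, teaching size. $\Phi_\ell^{\mathsf f}(S)$ (resp. $\Phi_\ell^{\mathsf f}(S|B)$) is the $\prec$-first program $p$ of $L$ (resp. of $L_B$) with $p\vDash_{\mathsf f}S$. $\Omega_\ell^{\mathsf f}(c)$ (resp. $\Omega_\ell^{\mathsf f}(c|B)$) is the $\lessdot$-first example set $S$ with $\Phi_\ell^{\mathsf f}(S)\in[c]_L$ (resp. $\Phi_\ell^{\mathsf f}(S|B)\in[c]_{L_B}$). $TS_\ell^{\mathsf f}(c)=\delta(\Omega_\ell^{\mathsf f}(c))$ and $TS_\ell^{\mathsf f}(c|B)=\delta(\Omega_\ell^{\mathsf f}(c|B))$. Conditioning on concepts.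 $K(c|B)=K_{L_B}(c)$ is the length $\ell$ of the $\prec$-first program of $L_B$ in $[c]_{L_B}$. For concepts $a,c_1,\dots,c_n\in C_L$, put $p_i=\Phi_\ell^{\mathsf f}(\Omega_\ell^{\mathsf f}(c_i))$ and $B=\{p_i\}_{i=1}^n$; then $TS_\ell^{\mathsf f}(a|c_1,\dots,c_n)=TS_\ell^{\mathsf f}(a|B)$ and $K(a|c_1,\dots,c_n)=K(a|B)$ (the same $\mathsf f$ is used to choose the programs $p_i$). *)

(* Defs.v *)
(* MathComp world; the only thing used from Stdlib's reals is log2. *)
From Stdlib Require Import Reals.
From mathcomp Require Import all_boot all_order finmap.

Set Implicit Arguments.
Unset Strict Implicit.
Unset Printing Implicit Defensive.

Definition str := seq bool.

(** [c i = None] means that the concept is undefined (does not halt) on [i]. *)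
Definition pfun := str -> option str.

(** ** Effective computability

    The reference model is a unary, variable-free form of Jones' WHILE language
    over binary trees ([Leaf] is nil and counts as false). *)

Inductive tree := Leaf | Node of tree & tree.

Inductive wprog :=
  | WId
  | WQuote of tree
  | WHd
  | WTl
  | WCons of wprog & wprog
  | WSeq of wprog & wprog
  | WIf of wprog & wprog & wprog
  | WWhile of wprog & wprog.

Inductive weval : wprog -> tree -> tree -> Prop :=
  | EId d : weval WId d d
  | EQuote k d : weval (WQuote k) d k
  | EHdLeaf : weval WHd Leaf Leaf
  | EHdNode x y : weval WHd (Node x y) x
  | ETlLeaf : weval WTl Leaf Leaf
  | ETlNode x y : weval WTl (Node x y) y
  | ECons g h d x y :
      weval g d x -> weval h d y -> weval (WCons g h) d (Node x y)
  | ESeq g h d x y : weval g d x -> weval h x y -> weval (WSeq g h) d y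
  | EIfTrue c g h d x y z :
      weval c d (Node x y) -> weval g d z -> weval (WIf c g h) d z
  | EIfFalse c g h d z :
      weval c d Leaf -> weval h d z -> weval (WIf c g h) d z
  | EWhileStop c g d : weval c d Leaf -> weval (WWhile c g) d d
  | EWhileStep c g d x y d1 d2 :
      weval c d (Node x y) -> weval g d d1 -> weval (WWhile c g) d1 d2 ->
      weval (WWhile c g) d d2.

Fixpoint tnat (n : nat) : tree :=
  if n is n'.+1 then Node Leaf (tnat n') else Leaf.

Definition tlist A (g : A -> tree) (s : seq A) : tree :=
  foldr (fun x t => Node (g x) t) Leaf s.

Definition topt A (g : A -> tree) (o : option A) : tree :=
  if o is Some x then Node Leaf (g x) else Leaf.

Definition tpair A B (g : A -> tree) (h : B -> tree) (p : A * B) : tree :=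
  Node (g p.1) (h p.2).

Definition tbool (b : bool) : tree := if b then Node Leaf Leaf else Leaf.

Definition tstr : str -> tree := tlist tbool.

Definition tord n (i : 'I_n) : tree := tnat i.

Fixpoint twprog (e : wprog) : tree :=
  match e with
  | WId => Node (tnat 0) Leaf
  | WQuote k => Node (tnat 1) k
  | WHd => Node (tnat 2) Leaf
  | WTl => Node (tnat 3) Leaf
  | WCons g h => Node (tnat 4) (Node (twprog g) (twprog h))
  | WSeq g h => Node (tnat 5) (Node (twprog g) (twprog h))
  | WIf c g h => Node (tnat 6) (Node (twprog c) (Node (twprog g) (twprog h)))
  | WWhile c g => Node (tnat 7) (Node (twprog c) (twprog g))
  end.

(** [RA x d]: the tree [d] represents [x]; an object may have several
    representatives. *)
Definition rep_by A (g : A -> tree) : A -> tree -> Prop := fun x d => d = g x.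

Definition computable_fun A B (RA : A -> tree -> Prop) (RB : B -> tree -> Prop)
    (h : A -> B) : Prop :=
  exists e : wprog,
    forall x d, RA x d -> exists2 d', weval e d d' & RB (h x) d'.

Definition wcomputes (e : wprog) (c : pfun) : Prop :=
  forall i d, weval e (tstr i) d <-> exists2 o, c i = Some o & d = tstr o.

(** ** Languages and programs

    [nbasic] counts the instructions of the alphabet other than [@], listed in
    lexicographic order. [exec p i t = Some o] means that [p] halts on [i] with
    output [o] within [t] steps. *)

Record language := Language {
  nbasic : nat;
  exec : seq 'I_nbasic -> str -> nat -> option str;
  exec_mono : forall p i t t' o,
    t <= t' -> exec p i t = Some o -> exec p i t' = Some o
}.

Definition prog (L : language) := seq 'I_(nbasic L).

Definition log2 (n : nat) : R := Rdiv (ln (INR n)) (ln (INR 2)).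

(** Bits per instruction; [@] belongs to the alphabet. *)
Definition ibits (L : language) : R := log2 (nbasic L).+1.

(** Common shape of a language [L] and of its extensions [L_B]; symbols are
    numbered in lexicographic order and [cost] is in bits. *)
Record coded := Coded {
  nsym : nat;
  cost : 'I_nsym -> R;
  cexec : seq 'I_nsym -> str -> nat -> option str
}.

Definition cprog (M : coded) := seq 'I_(nsym M).

(** Without a library there is nothing to call, so [@] does not occur. *)
Definition plain (L : language) : coded :=
  @Coded (nbasic L) (fun=> ibits L) (@exec L).

Section Library.
Variables (L : language) (B : seq (prog L)).

(** Symbols [i < nbasic L] are basic instructions; [nbasic L + j] is the call
    of the [j]-th primitive, so calls come last in lexicographic order. *)
Definition lib_cost (s : 'I_(nbasic L + size B)) : R :=
  if split s is inr _ then Rplus (ibits L) (log2 (size B)) else ibits L.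

Definition inline (p : seq 'I_(nbasic L + size B)) : prog L :=
  flatten [seq match split s with
               | inl i => [:: i]
               | inr j => tnth (in_tuple B) j
               end | s <- p].

(** Calls are static: running a program is running its unfolding. *)
Definition withlib : coded :=
  @Coded (nbasic L + size B) lib_cost (fun p => exec (inline p)).
End Library.

Definition plen (M : coded) (p : cprog M) : R :=
  foldr (fun s r => Rplus (cost s) r) R0 p.

Definition prec (M : coded) (p q : cprog M) : Prop :=
  Rlt (plen p) (plen q) \/
  plen p = plen q /\
    ((p : seqlexi 'I_(nsym M)) < q)%O.

Definition computes (M : coded) (p : cprog M) (c : pfun) : Prop :=
  forall i o, c i = Some o <-> exists t, cexec p i t = Some o.

Definition is_concept (L : language) (c : pfun) : Prop :=
  exists p : prog L, computes (M := plain L) p c.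

(** Turing-completeness: every program of the reference model can be
    effectively compiled to an equivalent program of [L]. *)
Definition universal (L : language) : Prop :=
  exists comp : wprog -> prog L,
    computable_fun (rep_by twprog) (rep_by (tlist (@tord (nbasic L)))) comp /\
    forall e c, wcomputes e c -> computes (M := plain L) (comp e) c.

(** ** Example sets

    A finite set of input-output pairs without different outputs for equal
    inputs is the graph of a finite map. *)

Definition exset := {fmap str -> option str}.

(** An example set is represented by any duplicate-free listing of it. *)
Definition rep_exset (S : exset) (d : tree) : Prop :=
  exists l : seq (str * option str),
    [/\ uniq l,
        forall i o, ((i, o) \in l) = (S.[? i] == Some o)%fmap
      & d = tlist (tpair tstr (topt tstr)) l].

Definition rep_opt A (RA : A -> tree -> Prop) (x : option A) (d : tree) : Prop :=
  if x is Some y then exists2 d', RA y d' & d = Node Leaf d' else d = Leaf.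

Definition prefix_code (enc : exset -> str) : Prop :=
  [/\ forall S S', prefix (enc S) (enc S') -> S = S',
      computable_fun rep_exset (rep_by tstr) enc
    & exists2 dec : str -> option exset,
        pcancel enc dec
      & computable_fun (rep_by tstr) (rep_opt rep_exset) dec].

Definition delta (enc : exset -> str) (S : exset) : nat := size (enc S).

Definition example_order (enc : exset -> str) (ltS : exset -> exset -> Prop) :
    Prop :=
  [/\ forall S, ~ ltS S S,
      forall S1 S2 S3, ltS S1 S2 -> ltS S2 S3 -> ltS S1 S3,
      forall S1 S2, S1 <> S2 -> ltS S1 S2 \/ ltS S2 S1
    & forall S1 S2, ltS S1 S2 -> delta enc S1 <= delta enc S2].

(** ** Time-bounded compatibility *)

Definition max_in (S : exset) : nat := \max_(i <- domf S) size i.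

Definition max_out (S : exset) : nat :=
  \max_(o <- codomf S) (if o is Some w then size w else 0).

Definition lambda (rho : nat) (i : str) (S : exset) : nat :=
  rho * minn (size i) (max_in S) + max_out S.

(** The output [None] in [S] asks that [p] has not halted by the bound. *)
Definition compat (M : coded) (rho : nat) (f : nat -> nat) (p : cprog M)
    (S : exset) : Prop :=
  forall i o, S.[? i]%fmap = Some o ->
    cexec p i (maxn (f (size i)) (lambda rho i S)) = o.

(** ** Learner, teacher, teaching size *)

Definition first_for T (lt : T -> T -> Prop) (P : T -> Prop) (x : T) : Prop :=
  P x /\ forall y, P y -> y <> x -> lt x y.

Section Teaching.
Variables (rho : nat) (enc : exset -> str) (ltS : exset -> exset -> Prop).
Variable f : nat -> nat.

(** [learner M S p]: [Phi(S) = p] in the language [M]. *)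
Definition learner (M : coded) (S : exset) (p : cprog M) : Prop :=
  first_for (@prec M) (fun q => compat rho f q S) p.

(** [teacher M c S]: [Omega(c) = S] in the language [M]. *)
Definition teacher (M : coded) (c : pfun) (S : exset) : Prop :=
  first_for ltS (fun S' => exists2 p, learner S' p & @computes M p c) S.

Definition is_TS (M : coded) (c : pfun) (n : nat) : Prop :=
  exists2 S, teacher M c S & n = delta enc S.

Definition is_K (M : coded) (c : pfun) (r : R) : Prop :=
  exists2 p, first_for (@prec M) (fun q => computes q c) p & r = plen p.

Section Conditional.
Variable L : language.

(** [Phi(Omega(c)) = p] in [L]. *)
Definition taught_prog (c : pfun) (p : prog L) : Prop :=
  exists2 S, teacher (plain L) c S & learner (M := plain L) S p.

(** A library is a set of programs, hence [undup]. *)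
Definition library_of (cs : seq pfun) (B : seq (prog L)) : Prop :=
  exists2 ps, List.Forall2 taught_prog cs ps & B = undup ps.

Definition is_TS_cond (c : pfun) (cs : seq pfun) (n : nat) : Prop :=
  exists2 B, library_of cs B & is_TS (withlib B) c n.

Definition is_K_cond (c : pfun) (cs : seq pfun) (r : R) : Prop :=
  exists2 B, library_of cs B & is_K (withlib B) c r.
End Conditional.
End Teaching.

(* Main.v *)
(** Let [a] be the constant concept with value [w = v^(h+1)], where [h], computed
    by [a]'s own program (Kleene's recursion theorem) from the length [n] of that
    program, bounds the outputs in every example set encoded in at most [D] bits.
    Here [D] bounds the code lengths of the sets [{("", s)}] for all candidate
    strings [s], and there are more candidates than programs of length at most
    [n] with one library call available. Whatever the library, a nonempty
    example set for [a] contains the output [w], so it takes more than [D] bits.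
    Some candidate [s] is not the output on [""] of any program of length at most
    [n] calling [p_a]; the concept [b] that [{("", s)}] teaches given [a] then has
    [K(b|a) > n >= K(a|b)] and [TS(b|a) <= D < TS(a|b)].

    The concepts and programs are fixed first, for an unbounded learner; [f] is
    then chosen to exceed the halting times of the finitely many programs that
    matter, so that the time-bounded learner and teacher agree with the unbounded
    ones on the sets used. *)
Require Import Defs.
From Stdlib Require Import Reals ClassicalEpsilon.
From mathcomp Require Import all_boot all_order finmap.

Set Implicit Arguments.
Unset Strict Implicit.
Unset Printing Implicit Defensive.

(** * Loops in WHILE and the enumeration of bit strings *)

Definition wfold (g : wprog) : wprog :=
  WSeq (WWhile WHd (WCons (WSeq WHd WTl)
                      (WSeq (WCons (WSeq WHd WHd) WTl) g)))
       WTl.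

(** The loop state pairs the unread list with the accumulator; the empty list is [Leaf], which ends
    the loop, and the final [WTl] keeps the accumulator. *)
Lemma weval_fold A B (h : A -> tree) (r : B -> tree) (G : B -> A -> B) g :
    (forall b x, weval g (Node (h x) (r b)) (r (G b x))) ->
  forall s b, weval (wfold g) (Node (tlist h s) (r b)) (r (foldl G b s)).
Proof.
move=> gP s b; apply: (@ESeq _ _ _ (Node Leaf (r (foldl G b s)))); last by constructor.
elim: s b => [|x s IHs] b /=; first by apply: EWhileStop; constructor.
apply: (EWhileStep _ _ (IHs (G b x))); first by constructor.
by repeat (econstructor || exact: gP).
Qed.

Fixpoint wrepeat (k : nat) (g : wprog) : wprog :=
  if k is k'.+1 then WSeq (wrepeat k' g) g else WId.

Lemma weval_repeat A (r : A -> tree) (G : A -> A) g :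
    (forall x, weval g (r x) (r (G x))) ->
  forall k x, weval (wrepeat k g) (r x) (r (iter k G x)).
Proof.
by move=> gP; elim=> [|k IHk] x /=; [constructor | apply: ESeq (IHk x) (gP _)].
Qed.

(** Keeping [s] itself makes the rounds cumulative, so shorter strings are never lost. Repetitions
    do no harm, since only upper bounds are drawn from these lists. *)
Definition grow (L : seq str) : seq str :=
  foldl (fun acc s => [:: s, true :: s, false :: s & acc]) [::] L.

Definition wgrow : wprog :=
  WSeq (WCons WId (WQuote Leaf))
    (wfold (WCons WHd (WCons (WCons (WQuote (tbool true)) WHd)
                         (WCons (WCons (WQuote (tbool false)) WHd) WTl)))).

Lemma weval_grow L : weval wgrow (tlist tstr L) (tlist tstr (grow L)).
Proof.
apply: ESeq; first by repeat constructor.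
have /= := @weval_fold _ _ tstr (tlist tstr)
  (fun acc s => [:: s, true :: s, false :: s & acc]) _ _ L [::].
by apply=> b x; repeat econstructor.
Qed.

Lemma mem_grow L s : s \in L ->
  [/\ s \in grow L, true :: s \in grow L & false :: s \in grow L].
Proof.
rewrite /grow; set G := fun _ _ => _.
have keep acc M x : x \in acc -> x \in foldl G acc M.
  elim: M acc => //= y M IHM acc xacc; apply: IHM.
  by rewrite !inE xacc !orbT.
elim: L [::] => //= y L IHL acc.
rewrite inE => /orP[/eqP->|/IHL]; last exact.
by split; apply: keep; rewrite !inE eqxx ?orbT.
Qed.

Lemma mem_iter_grow s k : size s <= k -> s \in iter k grow [:: [::]].
Proof.
elim: k s => [|k IHk] [|c s] //= sz; last first.
  by have [_ ? ?] := mem_grow (IHk s sz); case: c.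
by have [] := mem_grow (IHk [::] isT).
Qed.

Lemma foldl_const A B (G : B -> B) (b : B) (s : seq A) :
  foldl (fun b _ => G b) b s = iter (size s) G b.
Proof. by elim: s b => //= x s IHs b; rewrite IHs -iterSr. Qed.

(** Replaces arithmetic in WHILE programs: nested loops run their body a sum of lengths many times,
    without representing any number. *)
Lemma foldl_iter A B (F : A -> nat) (G : B -> B) (b : B) (s : seq A) :
  foldl (fun b x => iter (F x) G b) b s = iter (\sum_(x <- s) F x) G b.
Proof.
elim: s b => [|x s IHs] b /=; first by rewrite big_nil.
by rewrite IHs big_cons -iterD addnC.
Qed.

Definition example (s : str) : exset := ([fmap].[[::] <- Some s])%fmap.

Lemma example_fnd s i o :
  ((example s).[? i])%fmap = Some o <-> i = [::] /\ o = Some s.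
Proof.
rewrite /example fnd_set; case: eqP => [->|ne].
  by split=> [[->]|[_ ->]].
by rewrite fnd_fmap0; split=> // -[].
Qed.

Lemma rep_example s :
  rep_exset (example s) (tlist (tpair tstr (topt tstr)) [:: ([::], Some s)]).
Proof.
exists [:: ([::], Some s)]; split=> // i o; rewrite inE.
apply/eqP/eqP => [[-> ->]|/example_fnd[-> ->] //].
exact/example_fnd.
Qed.

(** * Computing a bound on the outputs in example sets with short codes *)

Section Escape.
Variables (enc : exset -> str) (enc_prefix : prefix_code enc) (N q : nat) (v : bool).

Definition candidates (n : nat) : seq str := iter (q * n).+1 grow [:: [::]].

(** Sums replace maxima throughout: a sum of lengths bounds each summand and is what nested loops
    count. The bit [v] is left free so that two different constants are available. *)
Lemma escape : exists (e : wprog) (H : nat -> nat),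
  [/\ forall p : seq 'I_N, weval e (tlist (@tord N) p) (tstr (nseq (H (size p)).+1 v))
    & forall n s S i w, size s <= (q * n).+1 -> delta enc S <= delta enc (example s) ->
        (S.[? i])%fmap = Some (Some w) -> size w <= H n].
Proof.
case: enc_prefix => _ [eenc eencP] [dec decK [edec edecP]].
have encP s : weval eenc (tlist (tpair tstr (topt tstr)) [:: ([::], Some s)]) (tstr (enc (example s))).
  by have [d' ? <-] := eencP _ _ (rep_example s).
(* A set has several listings, so [lst s] is chosen as the one that [edec] really outputs. [WTl]
   strips the [Some] tag and turns a failed decoding into the empty list. *)
have [lst lstP] : exists lst : str -> seq (str * option str), forall s,
    weval (WSeq edec WTl) (tstr s) (tlist (tpair tstr (topt tstr)) (lst s)) /\
    forall S, dec s = Some S ->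
      forall i o, ((i, o) \in lst s) = (S.[? i] == Some o)%fmap.
  suff H s : exists l, weval (WSeq edec WTl) (tstr s) (tlist (tpair tstr (topt tstr)) l) /\
      forall S, dec s = Some S ->
        forall i o, ((i, o) \in l) = (S.[? i] == Some o)%fmap.
    exists (fun s => proj1_sig (constructive_indefinite_description _ (H s))) => s.
    by case: constructive_indefinite_description.
  have [d' ev] := edecP s _ erefl.
  case: (dec s) => [S|] /=; last first.
    by move=> E; subst d'; exists [::]; split=> //; apply: ESeq ev _; constructor.
  case=> d'' [l [_ lP ->]] E; subst d'; exists l; split; last by move=> _ [<-].
  by apply: ESeq ev _; constructor.
pose total n := \sum_(s <- candidates n) delta enc (example s).
pose wt (x : str * option str) := size (odflt [::] x.2).
pose H n := \sum_(s <- iter (total n) grow [:: [::]]) \sum_(x <- lst s) wt x.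
(* With [n] the length of the input program, [e1] lists [candidates n], [e2] turns this into a list
   of the strings of length up to [total n], and [e3] decodes them all, adding to [[:: v]] one [v]
   per output bit. *)
pose e1 := WSeq (WCons WId (WQuote (tlist tstr [:: [::]])))
             (WSeq (wfold (WSeq WTl (wrepeat q wgrow))) wgrow).
pose single := WCons (WCons (WQuote Leaf) (WCons (WQuote Leaf) WHd)) (WQuote Leaf).
pose e2 := WSeq (WCons WId (WQuote (tlist tstr [:: [::]])))
             (wfold (WSeq (WCons (WSeq single eenc) WTl)
                          (wfold (WSeq WTl wgrow)))).
pose e3 := WSeq (WCons WId (WQuote (tstr [:: v])))
             (wfold (WSeq (WCons (WSeq WHd (WSeq edec WTl)) WTl)
                (wfold (WSeq (WCons (WSeq WHd (WSeq WTl WTl)) WTl)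
                   (wfold (WCons (WQuote (tbool v)) WTl)))))).
exists (WSeq e1 (WSeq e2 e3)), H; split=> [p|n s S i w sz le Siw].
  apply: (@ESeq _ _ _ (tlist tstr (candidates (size p)))).
    apply: ESeq; first by repeat constructor.
    apply: (@ESeq _ _ _ (tlist tstr (iter (q * size p) grow [:: [::]]))); last first.
      exact: weval_grow.
    have := @weval_fold _ _ (@tord N) (tlist tstr)
      (fun L _ => iter q grow L) (WSeq WTl (wrepeat q wgrow)) _ p [:: [::]].
    rewrite foldl_iter big_const_seq count_predT iter_addn_0; apply=> L x.
    by apply: ESeq; [constructor|apply: weval_repeat weval_grow _ _].
  apply: (@ESeq _ _ _ (tlist tstr (iter (total (size p)) grow [:: [::]]))).
    apply: ESeq; first by repeat constructor.
    rewrite /total -foldl_iter.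
    apply: (@weval_fold _ _ tstr (tlist tstr) _ _ _ _ [:: [::]]) => L s.
    apply: ESeq.
      apply: ECons; last by constructor.
      by apply: ESeq (encP s); repeat constructor.
    rewrite /delta -foldl_const; apply: weval_fold => L' x.
    by apply: ESeq; [constructor|apply: weval_grow].
  apply: ESeq; first by repeat constructor.
  have -> : nseq (H (size p)).+1 v = iter (H (size p)) (cons v) [:: v].
    by elim: (H _) => //= k <-.
  rewrite /H -foldl_iter.
  apply: (@weval_fold _ _ tstr tstr _ _ _ _ [:: v]) => L s.
  apply: ESeq.
    apply: ECons; last by constructor.
    by apply: ESeq; [constructor|exact: (lstP s).1].
  rewrite -foldl_iter; apply: weval_fold => L' x.
  apply: (@ESeq _ _ _ (Node (tstr (odflt [::] x.2)) (tstr L'))).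
    apply: ECons; last by constructor.
    apply: ESeq; first by constructor.
    apply: ESeq; first by constructor.
    by case: (x.2) => [u|]; constructor.
  rewrite /wt -foldl_const; apply: weval_fold => L'' c.
  by repeat constructor.
(* The code length of [example s] is a summand of [total n], so [enc S] is among the decoded
   strings; then [size w] is a summand of [H n]. *)
have enc_mem : enc S \in iter (total n) grow [:: [::]].
  apply/mem_iter_grow/(leq_trans le).
  have smem : s \in candidates n by apply: mem_iter_grow.
  by rewrite /total (big_rem _ smem) leq_addr.
have mem : (i, Some w) \in lst (enc S).
  by rewrite ((lstP (enc S)).2 S (decK S)) Siw.
rewrite /H (big_rem _ enc_mem) /= (big_rem _ mem) /=.
by rewrite -addnA leq_addr.
Qed.
End Escape.

(** * Determinism of WHILE, the recursion theorem and lookup tables *)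

Lemma weval_det e d x y : weval e d x -> weval e d y -> x = y.
Proof.
move=> H; elim: H y => {e d x}.
- by move=> d y H; inversion H.
- by move=> k d y H; inversion H.
- by move=> y H; inversion H.
- by move=> a b y H; inversion H.
- by move=> y H; inversion H.
- by move=> a b y H; inversion H.
- move=> g h d a b _ IHg _ IHh y H; inversion H; subst.
  by rewrite (IHg x) // (IHh y0).
- move=> g h d a b _ IHg _ IHh y H; inversion H; subst.
  by apply: IHh; rewrite (IHg x).
- move=> c g h d a b z _ IHc _ IHg y H; inversion H; subst; first exact: IHg.
  by match goal with K : weval c d Leaf |- _ => have := IHc _ K end.
- move=> c g h d z _ IHc _ IHh y H; inversion H; subst; last exact: IHh.
  by match goal with K : weval c d (Node _ _) |- _ => have := IHc _ K end.
- move=> c g d _ IHc y H; inversion H; subst => //.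
  by match goal with K : weval c _ (Node _ _) |- _ => have := IHc _ K end.
- move=> c g d a b d1 d2 _ IHc _ IHg _ IHw y H; inversion H; subst.
    by match goal with K : weval c _ Leaf |- _ => have := IHc _ K end.
  by apply: IHw; rewrite (IHg d3).
Qed.

(* Kleene's recursion theorem: a program has access to its own compiled code. *)
Lemma recursion (L : language) (h : prog L -> str) (e : wprog) :
  universal L -> (forall p, weval e (tlist (@tord (nbasic L)) p) (tstr (h p))) ->
  exists p : prog L, computes (M := plain L) p (fun=> Some (h p)).
Proof.
move=> [comp [[ecomp ecompP] compP]] eP.
(* Tags 5 and 1 stand for [WSeq] and [WQuote] in [twprog]: given [twprog u], the first stage of [u]
   builds the code of [WSeq (WQuote (twprog u)) u], which is [P]. *)
pose u := WSeq (WCons (WQuote (tnat 5))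
                  (WCons (WCons (WQuote (tnat 1)) WId) WId)) (WSeq ecomp e).
pose P := WSeq (WQuote (twprog u)) u.
have evP d : weval P d (tstr (h (comp P))).
  apply: ESeq; first by constructor.
  apply: (@ESeq _ _ _ (twprog P)); first by repeat constructor.
  have [d' ev E] := ecompP P _ erefl; rewrite {d'}E in ev.
  exact: ESeq ev (eP _).
exists (comp P); apply: compP => i d; split=> [/weval_det ev|[_ [<-] ->]//].
by exists (h (comp P)) => //; apply: ev.
Qed.

Lemma weval_seq g h d x y : weval g d x -> weval (WSeq g h) d y <-> weval h x y.
Proof.
move=> gx; split=> [H|]; last exact: ESeq.
by inversion H as [| | | | | | |g' h' d' x' y' gx' hy| | | |]; rewrite (weval_det gx gx').
Qed.

Lemma weval_if c g h d x y : weval c d x ->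
  weval (WIf c g h) d y <-> weval (if x is Node _ _ then g else h) d y.
Proof.
move=> cx; split=> [H|].
  inversion H as [| | | | | | | |c' g' h' d' u u' z cu gy|c' g' h' d' z cl hy| |].
    by rewrite (weval_det cx cu).
  by rewrite (weval_det cx cl).
by case: x cx => [|u u'] cx; [apply: EIfFalse cx|apply: EIfTrue cx].
Qed.

Definition wloop : wprog := WWhile (WQuote (Node Leaf Leaf)) WId.

Lemma weval_loop d d' : ~ weval wloop d d'.
Proof.
move=> H; have : wloop = wloop by []; rewrite {2}/wloop.
elim: H => // {d d'}.
by move=> c g d H _ [E _]; subst c; inversion H.
Qed.

(** A trie on the input bits. It must diverge, not merely answer a default, where [c] is undefined,
    since example sets may demand divergence. *)
Fixpoint wtable (n : nat) (c : pfun) : wprog :=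
  if n is n'.+1 then
    WIf WId
      (WIf WHd (WSeq WTl (wtable n' (fun i => c (true :: i))))
               (WSeq WTl (wtable n' (fun i => c (false :: i)))))
      (if c [::] is Some o then WQuote (tstr o) else wloop)
  else wloop.

Lemma wtableP n c :
  wcomputes (wtable n c) (fun i => if size i < n then c i else None).
Proof.
elim: n c => [|n IHn] c i d /=; first by split=> [/weval_loop//|[]//].
case: i => [|b i] /=.
  apply: iff_trans (weval_if _ _ _ (EId _)) _ => /=.
  case: (c [::]) => [o|]; last by split=> [/weval_loop|[]].
  split=> [H|[_ [<-] ->]]; last by constructor.
  by exists o => //; apply: weval_det H _; constructor.
rewrite ltnS; apply: iff_trans (weval_if _ _ _ (EId _)) _ => /=.
apply: iff_trans (weval_if _ _ _ (EHdNode _ _)) _.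
by case: b => /=; apply: iff_trans (weval_seq _ _ (ETlNode _ _)) (IHn _ _ _).
Qed.

(** * First elements of orders, and counting *)

Definition strict_total T (lt : T -> T -> Prop) : Prop :=
  [/\ forall x, ~ lt x x, forall x y z, lt x y -> lt y z -> lt x z
    & forall x y, x <> y -> lt x y \/ lt y x].

(** Induction on a list containing all predecessors of [x]: moving to a smaller element satisfying
    [P] removes that element from the list. *)
Lemma first_exists (T : eqType) (lt : T -> T -> Prop) (P : T -> Prop) (s : seq T) x :
  strict_total lt -> (forall y, lt y x -> y \in s) -> P x ->
  exists2 z, first_for lt P z & z = x \/ lt z x.
Proof.
move=> [irr tr tot]; move: {2}(size s) (leqnn (size s)) => n.
elim: n => [|n IHn] in s x *.
  rewrite leqn0 size_eq0 => /eqP-> below Px; exists x; last by left.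
  by split=> // y Py /tot[/below|].
move=> sz below Px; case: (classic (exists2 y, P y & lt y x)) => [[y Py yx]|no].
  have ys := below y yx.
  have [|z yz|z first_z zy] := IHn (rem y s) y _ _ Py.
  - by rewrite size_rem //; case: (s) sz.
  - have zs := below z (tr _ _ _ yz yx).
    have : z \in y :: rem y s by rewrite -(perm_mem (perm_to_rem ys)).
    by rewrite inE => /orP[/eqP E|//]; case: (irr y); rewrite -{1}E.
  - by exists z => //; right; case: zy => [->//|zy]; apply: tr yx.
exists x; last by left.
by split=> // y Py /tot[yx|//]; case: no; exists y.
Qed.

Definition short_seqs (T : finType) (n : nat) : seq (seq T) :=
  [seq (b : seq T) | b : {bseq n of T}].

Lemma mem_short_seqs (T : finType) n (s : seq T) : size s <= n -> s \in short_seqs T n.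
Proof.
by move=> sz; apply/mapP; exists (Bseq sz) => //; rewrite mem_enum.
Qed.

(** The estimate [#|T| < 2 ^ #|T|] turns the geometric sum into a power of two, comparable with a
    number of bit strings. *)
Lemma size_short_seqs (T : finType) n :
  size (short_seqs T n) < 2 ^ (#|T| * n).+1.
Proof.
rewrite size_map -cardE card_bseq; elim: n => [|n IHn].
  by rewrite big_ord_recl big_ord0 muln0.
rewrite big_ord_recr /=; case: (posnP #|T|) => [->|T_gt0] in IHn *.
  by rewrite exp0n // addn0; apply: leq_trans IHn _; rewrite leq_exp2l.
rewrite [2 ^ _]expnS mul2n -addnn -addSn leq_add //.
  by apply: leq_trans IHn _; rewrite leq_exp2l // mulnS -add1n leq_add2r.
by rewrite expnM leq_exp2r // ltnW // ltn_expl.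
Qed.

(** Pigeonhole: bit strings of this length outnumber the sequences of length at most [n]. *)
Lemma fresh_string (T : finType) n (out : seq T -> option str) :
  exists2 s, size s = (#|T| * n).+1 & forall p, size p <= n -> out p <> Some s.
Proof.
set Z := (_ * n).+1.
pose strings := [seq Some (t : str) | t : Z.-tuple bool].
have strings_uniq : uniq strings.
  by rewrite map_inj_uniq ?enum_uniq // => t t' [/val_inj].
have [/allP sub|/allPn[_ /mapP[t _ ->] no]] :=
  boolP (all [in [seq out p | p <- short_seqs T n]] strings).
  have := uniq_leq_size strings_uniq sub.
  by rewrite size_map -cardE card_tuple card_bool size_map leqNgt size_short_seqs.
exists t; first exact: size_tuple.
by move=> p /mem_short_seqs sp E; case/negP: no; rewrite /= -E map_f.
Qed.

(** Gives every example set finitely many [ltS]-predecessors, so that the teacher's choice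
    exists. *)
Lemma small_sets_finite enc D : prefix_code enc ->
  exists l : seq exset, forall S, delta enc S <= D -> S \in l.
Proof.
move=> [_ _ [dec decK _]]; exists (pmap dec (short_seqs bool D)) => S le.
by rewrite mem_pmap; apply/mapP; exists (enc S); first exact: mem_short_seqs.
Qed.

(** * Learning and teaching when all symbols have the same cost *)

Section Coded.
Variables (M : coded) (r : R).
Hypotheses (r_gt0 : Rlt 0 r) (costE : forall s, @cost M s = r).
Hypothesis exec_monoM : forall (p : cprog M) i t t' o, t <= t' ->
  cexec p i t = Some o -> cexec p i t' = Some o.

Lemma plenE (p : cprog M) : plen p = Rmult (INR (size p)) r.
Proof.
elim: p => [|s p IHp]; first by rewrite /= Rmult_0_l.
by rewrite [plen _]/= -/(plen p) IHp costE -[size (s :: p)]/((size p).+1) S_INR; ring.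
Qed.

Lemma plen_lt (p q : cprog M) : Rlt (plen p) (plen q) <-> size p < size q.
Proof.
rewrite !plenE; split=> [lt|/ltP/lt_INR lt].
  by apply/ltP/INR_lt/(Rmult_lt_reg_r r).
exact: Rmult_lt_compat_r.
Qed.

Lemma plen_eq (p q : cprog M) : plen p = plen q <-> size p = size q.
Proof.
rewrite !plenE; split=> [E|->//].
by apply: INR_eq; apply: Rmult_eq_reg_r E _; apply: Rgt_not_eq.
Qed.

Lemma prec_strict_total : strict_total (@prec M).
Proof.
split.
- by move=> p [/plen_lt|[_]]; [rewrite ltnn|rewrite Order.POrderTheory.ltxx].
- move=> p q s [/plen_lt pq|[pq lpq]] [/plen_lt qs|[qs lqs]].
  + by left; apply/plen_lt; apply: ltn_trans qs.
  + by left; apply/plen_lt; move/plen_eq: qs => <-.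
  + by left; apply/plen_lt; move/plen_eq: pq => ->.
  + by right; split; [rewrite pq|apply: Order.POrderTheory.lt_trans lqs].
move=> p q ne; case: (ltngtP (size p) (size q)) => [lt|lt|eq].
- by left; left; apply/plen_lt.
- by right; left; apply/plen_lt.
have /orP[lt|lt] : ((p : seqlexi 'I_(nsym M)) < q)%O || ((q : seqlexi 'I_(nsym M)) < p)%O.
- by apply: Order.TotalTheory.lt_total; apply/eqP.
- by left; right; split=> //; apply/plen_eq.
- by right; right; split=> //; apply/plen_eq.
Qed.

Lemma prec_size (p q : cprog M) : prec p q -> size p <= size q.
Proof. by case=> [/plen_lt/ltnW|[/plen_eq->]]. Qed.

Lemma first_prog (P : cprog M -> Prop) p : P p ->
  exists2 q, first_for (@prec M) P q & size q <= size p.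
Proof.
move=> Pp.
have [|q Pq H] := first_exists (s := short_seqs _ (size p)) prec_strict_total _ Pp.
  by move=> q /prec_size; apply: mem_short_seqs.
by exists q => //; case: H => [->//|/prec_size].
Qed.

Lemma first_prog_unique (P : cprog M -> Prop) p q :
  first_for (@prec M) P p -> P q -> q = p \/ prec p q.
Proof.
by move=> [_ H] Pq; case: (classic (q = p)) => [|ne]; [left|right; apply: H].
Qed.

Lemma computes_exists (p : cprog M) : exists c, computes p c.
Proof.
suff H i : exists x : option str, forall o, x = Some o <-> exists t, cexec p i t = Some o.
  exists (fun i => proj1_sig (constructive_indefinite_description _ (H i))) => i.
  by case: constructive_indefinite_description.
case: (classic (exists o t, cexec p i t = Some o)) => [[o [t E]]|no]; last first.
  by exists None => o; split=> // -[t E]; case: no; exists o, t.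
exists (Some o) => o'; split=> [[<-]|[t' E']]; first by exists t.
have [le|le] := orP (leq_total t t').
  by rewrite -E' (exec_monoM le E).
by rewrite -E (exec_monoM le E').
Qed.

Lemma computes_unique (p : cprog M) c c' : computes p c -> computes p c' -> c =1 c'.
Proof.
move=> H H' i; case E: (c i) => [o|]; first by rewrite (H' i o).2 //; apply/H.
by case E': (c' i) => [o|//]; rewrite -E; apply/H/H'.
Qed.

Lemma eq_computes (p : cprog M) c c' : c =1 c' -> computes p c -> computes p c'.
Proof. by move=> E H i o; rewrite -E. Qed.

(** For programs of size at most [W] the time bound loses nothing. A longer program may still pass
    for divergent when it is merely slow. *)
Definition dominates (f : nat -> nat) (W : nat) : Prop :=
  forall (p : cprog M) i t o, size p <= W ->
    cexec p i t = Some o -> cexec p i (f (size i)) = Some o.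

Definition agrees (c : pfun) (S : exset) : Prop :=
  forall i o, (S.[? i])%fmap = Some o -> c i = o.

Lemma compatP rho f W (p : cprog M) c S : dominates f W -> size p <= W ->
  computes p c -> compat rho f p S <-> agrees c S.
Proof.
move=> dom sz pc.
have bound i b : cexec p i (maxn (f (size i)) b) = c i.
  case E: (c i) => [o|].
    have /pc[t Et] := E; apply: exec_monoM (dom _ _ _ _ sz Et); exact: leq_maxl.
  by case E': (cexec _ _ _) => [o|//]; rewrite -E; symmetry; apply/pc; exists (maxn (f (size i)) b).
by split=> H i o /H; rewrite bound.
Qed.

(** An output seen within any time bound is genuine; only an example without output could mislead.
    Hence neither [f] nor the size of [p] is restricted. *)
Lemma compat_defined rho f (p : cprog M) c (S : exset) : computes p c ->
  (forall i, (S.[? i])%fmap <> Some None) -> compat rho f p S -> agrees c S.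
Proof.
move=> pc def H i [o|] E; last by case: (def i).
by apply/pc; eexists; apply: H E.
Qed.

Section Stable.
Variables (rho : nat) (enc : exset -> str) (ltS : exset -> exset -> Prop).
Hypotheses (enc_prefix : prefix_code enc) (ltS_order : example_order enc ltS).
Hypothesis expressive : forall S, exists (p : cprog M) c, computes p c /\ agrees c S.

Lemma ltS_strict_total : strict_total ltS.
Proof. by case: ltS_order. Qed.

Lemma teacher_exists f c S p : learner rho f S p -> @computes M p c ->
  exists2 S', teacher rho ltS f M c S' & delta enc S' <= delta enc S.
Proof.
move=> lp pc; have [_ _ _ ltS_delta] := ltS_order.
have [l small] := small_sets_finite (delta enc S) enc_prefix.
have [||S' first_S' H] := @first_exists _ ltS
    (fun S' => exists2 p, learner rho f S' p & @computes M p c)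
    l S ltS_strict_total.
- by move=> S' /ltS_delta; apply: small.
- by exists p.
by exists S' => //; case: H => [->//|/ltS_delta].
Qed.

(** Each rival [g x] different from [c] contributes one input where they differ; [S] is [c]
    restricted to these inputs, undefined values included. *)
Lemma separating_set (T : eqType) (g : T -> pfun) c (xs : seq T) :
  exists S, agrees c S /\ forall x, x \in xs -> agrees (g x) S -> g x =1 c.
Proof.
have [d dP] : exists d : T -> str, forall x, g x (d x) = c (d x) -> g x =1 c.
  suff H x : exists i, g x i = c i -> g x =1 c.
    exists (fun x => sval (constructive_indefinite_description _ (H x))) => x.
    by case: constructive_indefinite_description.
  case: (classic (exists i, g x i <> c i)) => [[i ne]|all_eq]; first by exists i.
  exists [::] => _ i; case: (classic (g x i = c i)) => // ne.
  by case: all_eq; exists i.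
pose A := [fset i in map d xs]%fset.
exists [fmap i : A => c (val i)]%fmap; split=> [i o|x xs_x ag].
  by case: fndP => // iA [<-]; rewrite ffunE.
apply: dP; apply: ag; have dA : d x \in A by rewrite in_fset map_f.
by rewrite in_fnd ffunE.
Qed.

(** The order of quantifiers matters: [W] and [p] are fixed before [f]. A set separating [c] from
    all programs no longer than [p] teaches [c], so the teacher's own set is one of finitely many,
    known before [f]. *)
Lemma stable c (p0 : cprog M) : computes p0 c ->
  exists W p, [/\ first_for (@prec M) (fun q => computes q c) p, size p <= W &
    forall f, dominates f W -> exists2 S, teacher rho ltS f M c S & learner rho f S p].
Proof.
move=> p0c.
have [p [pc first_p] _] := @first_prog (fun q => computes q c) _ p0c.
have conc q : {c' | computes q c'} := constructive_indefinite_description _ (computes_exists q).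
have [S0 [cS0 sep]] := separating_set (fun q => sval (conc q)) c (short_seqs _ (size p)).
have [l small] := small_sets_finite (delta enc S0) enc_prefix.
pose rS S := constructive_indefinite_description _ (expressive S).
(* For each set that the teacher might choose, [W] covers a program satisfying it without time
   bound; the learner's answer [p'] is no longer than that program. *)
pose W := maxn (size p) (\max_(S <- l) size (sval (rS S))).
have pW : size p <= W by apply: leq_maxl.
exists W, p; split=> // f dom.
have pS S : agrees c S -> compat rho f p S by move/(compatP rho _ dom pW pc).
have learn0 : learner rho f S0 p.
  split; first exact: pS.
  move=> q qS0 ne; have [_ _ /(_ p q)[|//|qp]] := prec_strict_total; first exact/nesym.
  have qW : size q <= W by apply: leq_trans pW; apply: prec_size.
  apply: first_p => //; apply: eq_computes (svalP (conc q)); apply: sep.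
    exact/mem_short_seqs/prec_size.
  exact/(compatP rho S0 dom qW (svalP (conc q))).
have [S tS leS] := teacher_exists learn0 pc.
exists S => //; case: (tS) => -[p' lp' p'c] _.
case: (lp') => p'S first_p'.
have p'W : size p' <= W.
  have [c' [qc' c'S]] := svalP (rS S).
  have qW : size (sval (rS S)) <= W.
    by rewrite /W leq_max (big_rem _ (small _ leS)) /= leq_maxl orbT.
  have qS : compat rho f (sval (rS S)) S by apply/(compatP rho S dom qW qc').
  case: (first_prog_unique lp' qS) => [<-//|/prec_size le].
  exact: leq_trans qW.
have cS : agrees c S by apply/(compatP rho S dom p'W p'c).
(* Otherwise [p'] precedes [p] and computes [c], although [p] is the first program for [c]. *)
have [->//|pp'] := first_prog_unique lp' (pS _ cS).
have [irr tr _] := prec_strict_total.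
case: (irr p); apply: (tr _ p') => //; apply: first_p => // E; apply: (irr p').
by rewrite {2}E.
Qed.
End Stable.
End Coded.

(** * Halting-time bounds and languages with a library *)

Lemma dominating_exists (L : language) W :
  exists f, dominates (plain L) f W.
Proof.
have [T TP] : exists T : prog L -> str -> nat, forall p i t o,
    exec p i t = Some o -> exec p i (T p i) = Some o.
  suff H (p : prog L) i : exists T, forall t o, exec p i t = Some o -> exec p i T = Some o.
    exists (fun p i => sval (constructive_indefinite_description _ (H p i))) => p i.
    by case: constructive_indefinite_description.
  case: (classic (exists t o, exec p i t = Some o)) => [[T [w Tw]]|no].
    exists T => t o E; have [le|le] := orP (leq_total t T); first exact: exec_mono E.
    by rewrite Tw -E (exec_mono le Tw).
  by exists 0 => t o E; case: no; exists t, o.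
(* Only finitely many programs and inputs matter for each [k]; runs that never halt contribute the
   time 0. *)
exists (fun k => \max_(p <- short_seqs 'I_(nbasic L) W)
                   \max_(i <- short_seqs bool k) T p i) => p i t o sz /TP.
apply: exec_mono; rewrite (big_rem p) /=; last exact: mem_short_seqs.
by rewrite (big_rem i) /= ?mem_short_seqs // leq_max leq_maxl.
Qed.

Section Languages.
Variable L : language.

Definition embed (B : seq (prog L)) (p : prog L) : cprog (withlib B) :=
  [seq lshift (size B) s | s <- p].

Lemma inline_embed B p : inline (embed B p) = p.
Proof.
rewrite /inline /embed -map_comp; elim: p => //= s p IHp.
have -> : split (lshift (size B) s) = inl s by apply: (canLR (@unsplitK _ _)).
by rewrite /= IHp.
Qed.

Lemma computes_embed B (p : prog L) c :
  computes (M := plain L) p c -> computes (embed B p) c.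
Proof. by move=> pc i o; rewrite /= inline_embed; apply: pc. Qed.

Lemma computes_inline B (p : cprog (withlib B)) c :
  computes p c -> computes (M := plain L) (inline p) c.
Proof. by []. Qed.

(** A symbol unfolds to one instruction or to [p]; [(size p).+1] bounds both, even for empty [p]. *)
Lemma size_inline (p : prog L) (q : cprog (withlib [:: p])) :
  size (inline q) <= size q * (size p).+1.
Proof.
rewrite /inline; elim: q => //= s q IHq.
rewrite size_cat mulSn leq_add //; case: (split s) => //= j.
by rewrite (ord1 j) (tnth_nth [::]) /=.
Qed.

Lemma dominates_withlib f W V (p : prog L) :
  dominates (plain L) f W -> V * (size p).+1 <= W ->
  dominates (withlib [:: p]) f V.
Proof.
move=> dom le q i t o sz; apply: dom; apply: leq_trans le.
by apply: leq_trans (size_inline q) _; rewrite leq_mul2r sz orbT.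
Qed.

Lemma dominates_le (M : coded) f V W : V <= W ->
  dominates M f W -> dominates M f V.
Proof. by move=> VW dom p i t o /leq_trans/(_ VW); apply: dom. Qed.

(** The index of a single primitive costs [log2 1 = 0] bits, so the results on uniform costs apply
    to one-program libraries. *)
Lemma cost_withlib (p : prog L) s : @cost (withlib [:: p]) s = ibits L.
Proof.
by rewrite /= /lib_cost; case: split => //= _; rewrite /log2 ln_1 /Rdiv Rmult_0_l Rplus_0_r.
Qed.

Hypothesis L_universal : universal L.

(** Without basic instructions the empty program would be the only one, but it cannot compute two
    different constants. *)
Lemma nbasic_gt0 : 0 < nbasic L.
Proof.
have [comp [_ compP]] := L_universal.
have const b : computes (M := plain L) (comp (WQuote (tstr [:: b]))) (fun=> Some [:: b]).
  apply: compP => i d; split=> [H|[_ [<-] ->]]; last by constructor.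
  by exists [:: b] => //; inversion H.
rewrite lt0n; apply/eqP => N0.
have nil (p : prog L) : p = [::] by case: p => // s; have := ltn_ord s; rewrite {2}N0.
have [t] := (const true [::] [:: true]).1 erefl.
rewrite (nil (comp _)) -(nil (comp (WQuote (tstr [:: false])))) => E.
by have := (const false [::] [:: true]).2 (ex_intro _ t E).
Qed.

Lemma ibits_gt0 : Rlt 0 (ibits L).
Proof.
have ln_gt0 n : 1 < n -> Rlt 0 (ln (INR n)).
  by move=> /ltP/lt_INR lt; rewrite -ln_1; apply: ln_increasing => //; apply: Rlt_0_1.
by apply: Rdiv_lt_0_compat; apply: ln_gt0 => //; rewrite ltnS nbasic_gt0.
Qed.

Lemma expressive_plain (S : exset) :
  exists (p : cprog (plain L)) c, computes p c /\ agrees c S.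
Proof.
have [comp [_ compP]] := L_universal.
(* The table answers only on lengths strictly below its depth, hence the successor. *)
exists (comp (wtable (max_in S).+1 (fun i => odflt None (S.[? i])%fmap))).
eexists; split; first exact/compP/wtableP.
move=> i o Sio; rewrite Sio; case: ifP => //; rewrite ltnS /max_in.
have iS : i \in domf S by rewrite -fndSome Sio.
by rewrite (big_fsetD1 i iS) /= leq_maxl.
Qed.

Lemma expressive_withlib (B : seq (prog L)) (S : exset) :
  exists (p : cprog (withlib B)) c, computes p c /\ agrees c S.
Proof.
have [p [c [pc cS]]] := expressive_plain S.
by exists (embed B p), c; split=> //; apply: computes_embed.
Qed.
End Languages.

(** * Construction of the two concepts *)

Lemma library_of1 rho ltS f (L : language) c (p : prog L) :
  taught_prog rho ltS f c p -> library_of rho ltS f [:: c] [:: p].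
Proof. by move=> pc; exists [:: p] => //; constructor. Qed.

Theorem theorem2 (L : language) (rho : nat) (enc : exset -> str)
    (ltS : exset -> exset -> Prop)
    (L_universal : universal L)
    (enc_prefix : prefix_code enc)
    (ltS_order : example_order enc ltS) :
  exists (a b : pfun) (f : nat -> nat),
    is_concept L a /\ is_concept L b /\
    exists (Kab Kba : R) (TSab TSba : nat),
      is_K_cond rho ltS f L a [:: b] Kab /\
      is_K_cond rho ltS f L b [:: a] Kba /\
      is_TS_cond rho enc ltS f L a [:: b] TSab /\
      is_TS_cond rho enc ltS f L b [:: a] TSba /\
      Rlt Kab Kba /\ TSab > TSba.
Proof.
pose M p := withlib (L := L) [:: p].
have r_gt0 := ibits_gt0 L_universal.
have cost0 s : @cost (plain L) s = ibits L by [].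
have costM p s : @cost (M p) s = ibits L := cost_withlib s.
have mono0 (p : cprog (plain L)) i t t' o : t <= t' ->
  cexec p i t = Some o -> cexec p i t' = Some o := @exec_mono L p i t t' o.
have monoM p (s : cprog (M p)) i t t' o : t <= t' ->
  cexec s i t = Some o -> cexec s i t' = Some o := @exec_mono L (inline s) i t t' o.
have expr0 := expressive_plain L_universal.
have exprM p : forall S, exists (s : cprog (M p)) c, computes s c /\ agrees c S :=
  expressive_withlib L_universal [:: p].
(* [w_e] will keep the empty example set from teaching [a]. The empty program computes at most one
   constant, so one of the two values of [v] is suitable. *)
have [w [pw [pw_w w_e w_long]]] : exists w (pw : prog L),
    [/\ computes (M := plain L) pw (fun=> Some w),
        ~ computes (M := plain L) [::] (fun=> Some w)
      & forall s (S : exset) i, size s = ((nbasic L + 1) * size pw).+1 ->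
          (S.[? i])%fmap = Some (Some w) -> delta enc (example s) < delta enc S].
  have self v : exists h (pw : prog L),
     computes (M := plain L) pw (fun=> Some (nseq h.+1 v)) /\
     forall s (S : exset) i, size s = ((nbasic L + 1) * size pw).+1 ->
          (S.[? i])%fmap = Some (Some (nseq h.+1 v)) -> delta enc (example s) < delta enc S.
    (* [nbasic L + 1] is the number of symbols with a one-program library, matching the string
       length in [fresh_string]. *)
    have [e [H [eP escP]]] := escape enc_prefix (nbasic L) (nbasic L + 1) v.
    have [p pP] := recursion L_universal eP.
    exists (H (size p)), p; split=> // s S i sz Si; rewrite ltnNge; apply/negP => le.
    have := escP (size p) s S i _ _ le Si; rewrite size_nseq ltnn => absurd.
    by have := absurd (eq_leq sz).
  have [h [pw [pwP H]]] := self true; have [h' [pw' [pwP' H']]] := self false.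
  case: (classic (computes (M := plain L) [::] (fun=> Some (nseq h.+1 true)))) => [T|nT].
    exists (nseq h'.+1 false), pw'; split=> // F.
    by have := computes_unique T F [::].
  by exists (nseq h.+1 true), pw.
pose a : pfun := fun=> Some w.
have [Wa [pa [pa_first _ pa_taught]]] :=
  stable r_gt0 cost0 mono0 rho enc_prefix ltS_order expr0 pw_w.
(* The primitive is the taught program [pa], possibly different from [pw]; the number of symbols
   does not depend on it, so [w_long] still fits. *)
have [s s_size s_fresh] := fresh_string (T := 'I_(nsym (M pa))) (size pw)
  (fun p => sval (constructive_indefinite_description _ (computes_exists (monoM pa) p)) [::]).
rewrite card_ord /= in s_size.
have example_defined i : ((example s).[? i])%fmap <> Some None.
  by move=> /example_fnd[].
have [qb0 [cb0 [qb0c cb0s]]] := exprM pa (example s).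
(* [qb] is the answer of the unbounded learner to [example s], and [b] is what it computes; neither
   depends on [f]. *)
have [qb [[b qb_b bs] qb_first] _] :=
  first_prog r_gt0 (costM pa) (P := fun q => exists2 c, computes q c & agrees c (example s))
    (ex_intro2 _ _ _ qb0c cb0s).
have b_nil : b [::] = Some s by apply: bs; apply/example_fnd.
have [Wb [pb [pb_first _ pb_taught]]] :=
  stable r_gt0 cost0 mono0 rho enc_prefix ltS_order expr0 (computes_inline qb_b).
have [Wab [qa [qa_first qaW qa_taught]]] :=
  stable r_gt0 (costM pb) (monoM pb) rho enc_prefix ltS_order (exprM pb)
    (computes_embed [:: pb] pw_w).
(* Sizes in a language with a library are multiplied by the unfolding factor of its primitive. *)
pose W := Wa + Wb + Wab * (size pb).+1 + size qb * (size pa).+1.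
have [f dom] := dominating_exists L W.
have [Sa Sa_teach Sa_learn] : exists2 S, teacher rho ltS f (plain L) a S & learner (M := plain L) rho f S pa.
  by apply: pa_taught; apply: dominates_le dom; rewrite /W -!addnA leq_addr.
have [Sb Sb_teach Sb_learn] : exists2 S, teacher rho ltS f (plain L) b S & learner (M := plain L) rho f S pb.
  by apply: pb_taught; apply: dominates_le dom; rewrite /W -!addnA addnCA leq_addr.
have dom_b : dominates (M pb) f Wab.
  by apply: dominates_withlib dom _; rewrite /W addnAC leq_addl.
have dom_a : dominates (M pa) f (size qb).
  by apply: dominates_withlib dom _; rewrite /W leq_addl.
have [Sab Sab_teach Sab_learn] := qa_taught f dom_b.
(* Since [example s] has no undefined output, [compat_defined] handles competitors of any size. *)
have qb_learn : learner rho f (example s) qb.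
  split; first exact/(compatP (monoM pa) rho _ dom_a (leqnn _) qb_b).
  move=> q q_s; apply: qb_first; have [c qc] := computes_exists (monoM pa) q.
  by exists c => //; apply: compat_defined qc example_defined q_s.
have [Sba Sba_teach Sba_le] := teacher_exists enc_prefix ltS_order qb_learn qb_b.
have [kb kb_first _] := first_prog r_gt0 (costM pa) (P := fun q => computes q b) qb_b.
have lib_a : library_of rho ltS f [:: a] [:: pa] by apply: library_of1; exists Sa.
have lib_b : library_of rho ltS f [:: b] [:: pb] by apply: library_of1; exists Sb.
exists a, b, f; split; first by exists pw.
split; first by exists (inline qb).
exists (plen qa), (plen kb), (delta enc Sab), (delta enc Sba).
split; first by exists [:: pb] => //; exists qa.
split; first by exists [:: pa] => //; exists kb.
split; first by exists [:: pb] => //; exists Sab.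
split; first by exists [:: pa] => //; exists Sba.
case: qa_first => qa_a qa_min; case: kb_first => kb_b _.
(* Both lengths are compared with [size pw]: [pw] without calls computes [a], while [kb] outputs the
   fresh string [s] on the empty input. *)
split.
  rewrite (plenE (costM pb)) (plenE (costM pa)); apply: Rmult_lt_compat_r => //.
  apply/lt_INR/ltP; apply: (@leq_ltn_trans (size pw)).
    rewrite -(size_map (lshift (size [:: pb])) pw).
    have [<-|/(prec_size r_gt0 (costM pb))//] :=
      first_prog_unique (conj qa_a qa_min) (computes_embed [:: pb] pw_w).
    exact: leqnn.
  rewrite ltnNge; apply/negP => /s_fresh; apply.
  case: constructive_indefinite_description => c kb_c /=.
  by rewrite -(computes_unique kb_b kb_c).
apply: (leq_ltn_trans Sba_le).
case: Sab_learn => qa_S Sab_min.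
have aS : agrees a Sab by apply/(compatP (monoM pb) rho _ dom_b qaW qa_a).
(* As [a] is constant, any example in [Sab] has output [w], and [w_long] applies. On the empty set
   every program is compatible, so the learner answers the empty program, against [w_e]. *)
case: (classic (exists i o, (Sab.[? i])%fmap = Some o)) => [[i [o Sio]]|empty].
  by apply: (w_long _ _ i s_size); rewrite Sio -(aS _ _ Sio).
case: w_e.
have : qa = [::].
  case E: qa => // [x qa']; have [|||[]] := Sab_min [::].
  - by move=> i o Sio; case: empty; exists i, o.
  - by rewrite E.
  - by rewrite E => /(plen_lt r_gt0 (costM pb)).
  - by rewrite E => /(plen_eq r_gt0 (costM pb)).
by move=> E; move: qa_a; rewrite E.
Qed.
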